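(* Let $G_\phi$ be a signed graph with universal sink $q$. Suppose $G_\phi$ is signed-regular with $m_-$ negative edges incident to each nonsink vertex. Then a valid configuration $\vec{c}\in S^+$ is critical if and only if $\vec{c}=\mathrm{stab}_{S^+}(\vec{c}+(1+2m_-)\vec{1})$, where $\vec{1}$ is the all-ones vector.
   Context: A signed graph $G_\phi$ is a finite simple graph $G=(V,E)$ with a sign function $\phi:E\to\{+,-\}$. A vertex $q$ is chosen as sink and $v_1,\dots,v_n$ are the other (nonsink) vertices. The sink is universal if it is adjacent to every other vertex. $G_\phi$ is signed-regular if the number of positive edges and the number $m_-$ of negative edges incident to $v$ are the same for all nonsink vertices $v$; here signs are taken into account only for edges between nonsink vertices, so $m_-$ counts negative edges joining $v$ to other nonsink vertices (edges to the sink may be regarded as positive, since their signs do not affect the reduced Laplacian). The reduced signed Laplacian $L=L_{G_\phi}$ is the $n\times n$ matrix with $L_{ii}=\deg_G(v_i)$ (counting edges to $q$) and, for $i\neq j$, $L_{ij}=-1$ if $v_iv_j$ is a positive edge, $+1$ if it is a negative edge, $0$ if it is not an edge. $M=L_G$ is the same matrix for the all-positive signing. Both are invertible and $M^{-1}$ has nonnegative entries. The valid configurations are $S^+=\{\vec{c}\in\mathbb{Z}^n: ML^{-1}\vec{c}\ge\vec{0}\}$. For $\vec{c}\in S^+$: site $i$ is ready to fire if $\vec{c}-L\vec{e}_i\in S^+$, and replacing $\vec{c}$ by $\vec{c}-L\vec{e}_i$ is then a legal firing; $\vec{c}$ is stable if no site is ready to fire; $\vec{c}$ is reachable if there is $\vec{d}\in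 S^+$ at which every site is ready to fire and from which $\vec{c}$ is obtained by a finite sequence of legal firings; $\vec{c}$ is critical if it is stable and reachable. $\mathrm{stab}_{S^+}(\vec{c})$ denotes the stable configuration obtained from $\vec{c}\in S^+$ by performing legal firings until no site is ready to fire (it exists and is unique). *)

(* Defs.v *)
From mathcomp Require Import all_boot all_order all_algebra.
From mathcomp Require Import classical_sets.
Set Implicit Arguments.
Unset Strict Implicit.
Unset Printing Implicit Defensive.
Import Order.TTheory GRing.Theory Num.Theory.
Local Open Scope ring_scope.

(* The values of [neg] matter only on pairs of adjacent vertices: an edge uv is
   negative if [neg u v] holds, and positive otherwise. *)
Record signed_graph (V : finType) := SignedGraph {
  adj : rel V;
  neg : rel V;
  adj_sym : symmetric adj;
  adj_irr : irreflexive adj;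
  neg_sym : symmetric neg
}.

Section SignedGraphs.
Variable V : finType.
Implicit Types (G : signed_graph V) (q v : V).

Definition pos_edge G : rel V := fun u v => adj G u v && ~~ neg G u v.
Definition neg_edge G : rel V := fun u v => adj G u v && neg G u v.

Definition deg G v : nat := #|[set u | adj G v u]|.

Definition all_positive G : signed_graph V :=
  @SignedGraph V (adj G) (fun _ _ => false) (@adj_sym V G) (@adj_irr V G)
    (fun _ _ => erefl).

Definition universal_sink G q : Prop := forall v, v != q -> adj G q v.

(* Only edges between nonsink vertices are counted. *)
Definition signed_regular G q (mneg : nat) : Prop :=
  exists mpos : nat, forall v, v != q ->
    #|[set u | (u != q) && pos_edge G v u]| = mpos /\
    #|[set u | (u != q) && neg_edge G v u]| = mneg.

Definition nonsink q : nat := #|[set~ q]|.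

Definition site q (i : 'I_(nonsink q)) : V := enum_val i.

Definition laplacian G q : 'M[int]_(nonsink q) :=
  \matrix_(i, j)
    if i == j then (deg G (site i))%:Z
    else if pos_edge G (site i) (site j) then -1
    else if neg_edge G (site i) (site j) then 1
    else 0.

End SignedGraphs.

Notation config q := 'cV[int]_(nonsink q).
Notation toQ := (map_mx (intr : int -> rat)).

Section Firing.
Variables (V : finType) (G : signed_graph V) (q : V).
Implicit Types (c d : config q) (i : 'I_(nonsink q)).

(* S^+; the inverse of L is taken over the rationals. *)
Definition valid c : bool :=
  [forall i, 0 <= (toQ (laplacian (all_positive G) q)
                     *m invmx (toQ (laplacian G q)) *m toQ c) i 0].

Definition fire c i : config q := c - laplacian G q *m delta_mx i 0.

Definition ready c i : bool := valid (fire c i).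

Definition legal_firing : rel (config q) :=
  fun c d => valid c && [exists i, ready c i && (d == fire c i)].

Definition fires_to c d : Prop :=
  exists2 s : seq (config q), path legal_firing c s & last c s = d.

Definition stable c : Prop := forall i, ~~ ready c i.

Definition reachable c : Prop :=
  exists d, [/\ valid d, forall i, ready d i & fires_to d c].

Definition critical c : Prop := stable c /\ reachable c.

(* The default value 0 is irrelevant for valid c when L and M are invertible
   and M^-1 is nonnegative: exactly one such d then exists. *)
Definition stab c : config q := xget 0 (fun d => fires_to c d /\ stable d).

End Firing.

(* Main.v *)
Require Import Defs.
From mathcomp Require Import all_boot all_order all_algebra.
From mathcomp Require classical_sets.
From mathcomp Require Import zify lra.
Import Order.TTheory GRing.Theory Num.Theory.
Local Open Scope ring_scope.

Set Implicit Arguments.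
Unset Strict Implicit.
Unset Printing Implicit Defensive.

(** Write [L] and [M] for the reduced Laplacians of the signed graph and of its
    all-positive signing.  In the coordinates [y = M L^-1 c] (the [potential] of
    [c]) validity means [y >= 0] and firing site [i] subtracts [M e_i]: the
    signed dynamics on [S^+] is ordinary chip-firing on the underlying graph,
    except that the entries of [y] are rational.  The off-diagonal entries of [M]
    are nonpositive, and its rows and columns sum to 1 because the sink is
    universal.  Two facts follow.

    - Firings commute: a ready site stays ready when another one fires
      ([ready_fire]), so every legal sequence extends to the stable
      configuration, if there is one ([fires_to_confluent]).
    - Each firing lowers the sum of the potential by exactly 1, so every valid
      configuration stabilizes ([stabilizable]).  With confluence, [stab c] is
      then the only stable configuration to which [c] fires ([stabP]).

    Signed regularity says that every row of [L] has sum [k = 1 + 2 m_-], so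
    [k 1 = L 1]: adding [k 1] undoes one firing of every site, and raises each
    coordinate of the potential by 1.  Dhar's burning argument then applies.

    If [c] is critical, say reached from [d] where all sites are ready, then
    [d + L 1] reaches [c + L 1], by the same firings as from [d] to [c].  It also
    reaches [c]: each site of [d + L 1] can fire once, in any order, which leads
    to [d] ([fires_to_burn]), and [d] reaches [c].  As [c] is stable, confluence
    shows that [c + L 1] stabilizes to [c].

    Conversely, if [c + L 1] stabilizes to [c], then [c + N L 1] reaches [c] for
    every [N], and for large [N] its potential is so large that all sites are
    ready. *)

(** * The reduced Laplacian with a universal sink *)

(** Levy-Desplanques: at a coordinate where a kernel vector has maximal absolute
    value, the diagonal term cannot be cancelled by the other ones. *)
Lemma diag_dominant_unitmx (F : realFieldType) (n : nat) (A : 'M[F]_n) :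
  (forall i, \sum_(j | j != i) `|A i j| < `|A i i|) -> A \in unitmx.
Proof.
move=> domA; rewrite -unitmx_tr -row_free_unit; apply: inj_row_free => v vA0.
apply/eqP; apply: contraT => /rV0Pn[i0 vi0].
pose i := [arg max_(i > i0) `|v 0 i|]%O.
have vmax j : `|v 0 j| <= `|v 0 i|.
  by rewrite /i; case: Order.TotalTheory.arg_maxP => // k _; apply.
have vi_gt0 : 0 < `|v 0 i| by apply: lt_le_trans (vmax i0); rewrite normr_gt0.
have /matrixP/(_ 0 i) := vA0; rewrite !mxE (bigD1 i) //= mxE.
move/eqP; rewrite addr_eq0 => /eqP/(congr1 Num.norm).
rewrite normrN normrM mulrC => Evi.
have : `|A i i| * `|v 0 i| <= (\sum_(j | j != i) `|A i j|) * `|v 0 i|.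
  rewrite Evi mulr_suml; apply: le_trans (ler_norm_sum _ _ _) _.
  apply: ler_sum => j _; rewrite mxE normrM mulrC.
  by apply: ler_wpM2l.
by rewrite ler_pM2r // leNgt domA.
Qed.

Section Laplacian.
Variables (V : finType) (G : signed_graph V) (q : V).
Implicit Types i j : 'I_(nonsink q).
Hypothesis hq : universal_sink G q.

Lemma site_neq i : site i != q.
Proof. by have := enum_valP i; rewrite !inE. Qed.

Lemma laplacianE (H : signed_graph V) i j : laplacian H q i j =
  (deg H (site i))%:Z *+ (i == j) - (pos_edge H (site i) (site j))%:R
                                  + (neg_edge H (site i) (site j))%:R.
Proof.
rewrite mxE; case: eqVneq => [<-|_].
  by rewrite /pos_edge /neg_edge adj_irr subr0 addr0.
rewrite /pos_edge /neg_edge.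
by case: (adj H _ _); case: (neg H _ _).
Qed.

Lemma laplacian_all_positiveE i j : laplacian (all_positive G) q i j =
  (deg G (site i))%:Z *+ (i == j) - (adj G (site i) (site j))%:R.
Proof. by rewrite laplacianE /pos_edge /neg_edge /= andbT andbF addr0. Qed.

Lemma laplacian_all_positive_sym i j :
  laplacian (all_positive G) q i j = laplacian (all_positive G) q j i.
Proof.
rewrite !laplacian_all_positiveE adj_sym eq_sym.
by case: eqVneq => [->|].
Qed.

Lemma laplacian_all_positive_off_le0 i j :
  i != j -> laplacian (all_positive G) q i j <= 0.
Proof.
by move=> /negPf nij; rewrite laplacian_all_positiveE nij; case: (adj G _ _).
Qed.

Lemma sum_site (P : pred V) :
  \sum_(i < nonsink q) (P (site i))%:R = #|[set u | (u != q) && P u]|%:R :> int.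
Proof.
rewrite -natr_sum -(big_enum_val (fun u => P u : nat)) -sum1_card.
rewrite big_mkcond [in RHS]big_mkcond; congr (_%:R); apply: eq_bigr => u _.
by rewrite !inE; case: (u == q); case: (P u).
Qed.

Lemma deg_universal i :
  deg G (site i) = (1 + #|[set u | (u != q) && pos_edge G (site i) u]|
                      + #|[set u | (u != q) && neg_edge G (site i) u]|)%N.
Proof.
rewrite /deg (cardsD1 q) inE adj_sym hq ?site_neq //= -addnA.
congr addn; rewrite -cardsUI [_ :&: _](_ : _ = set0).
  rewrite cards0 addn0; apply: eq_card => u; rewrite !inE /pos_edge /neg_edge.
  by case: (u == q); case: (adj G _ _); case: (neg G _ _).
apply/setP=> u; rewrite !inE /pos_edge /neg_edge.
by case: (neg G _ _); rewrite !(andbT, andbF).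
Qed.

Lemma laplacian_row_sum i :
  \sum_j laplacian G q i j
  = (1 + 2 * #|[set u | (u != q) && neg_edge G (site i) u]|)%N%:Z.
Proof.
under eq_bigr do rewrite laplacianE.
rewrite big_split sumrB /= (bigD1 i) //= eqxx mulr1n.
rewrite [X in _ + X - _]big1 => [|j]; last by rewrite eq_sym => /negPf->.
rewrite !sum_site deg_universal !natz; lia.
Qed.
End Laplacian.

Section Dynamics.
Variables (V : finType) (G : signed_graph V) (q : V).
Implicit Types (i j l : 'I_(nonsink q)) (c d e : config q).
Hypothesis hq : universal_sink G q.

Local Notation L := (laplacian G q).
Local Notation M := (laplacian (all_positive G) q).

Lemma laplacian_all_positive_row_sum i : \sum_j M i j = 1.
Proof.
rewrite (laplacian_row_sum (G := all_positive G) hq) eq_card0 // => u.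
by rewrite !inE /neg_edge /= !andbF.
Qed.

Lemma laplacian_all_positive_col_sum j : \sum_i M i j = 1.
Proof.
rewrite -(laplacian_all_positive_row_sum j); apply: eq_bigr => i _.
exact: laplacian_all_positive_sym.
Qed.

(** Extending the sum to all columns only adds nonpositive terms, and then it
    is 1. *)
Lemma laplacian_all_positive_sum_ge0 (A : {set 'I_(nonsink q)}) l :
  l \in A -> 0 <= \sum_(i in A) M l i.
Proof.
move=> lA; have : 0 <= \sum_i M l i by rewrite laplacian_all_positive_row_sum.
rewrite (bigID (mem A)) /= => /le_trans; apply.
rewrite gerDl; apply: sumr_le0 => i iA; apply: laplacian_all_positive_off_le0.
by apply: contraNneq iA => <-.
Qed.

(** Passing from [L] to [M] keeps the absolute values of the entries, and the
    rows of [M] sum to 1, so [L] is diagonally dominant. *)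
Lemma laplacian_unitmx : toQ L \in unitmx.
Proof.
apply: diag_dominant_unitmx => i.
have normL j : j != i -> `|toQ L i j| = - (M i j)%:~R.
  move=> nji; rewrite mxE laplacianE laplacian_all_positiveE eq_sym (negPf nji).
  by rewrite /pos_edge /neg_edge; case: (adj G _ _); case: (neg G _ _).
have diagL : toQ L i i = (M i i)%:~R.
  by rewrite mxE laplacianE laplacian_all_positiveE /pos_edge /neg_edge adj_irr addr0.
under eq_bigr => j nji do rewrite normL //.
rewrite sumrN; apply: lt_le_trans (ler_norm _); rewrite diagL -subr_gt0 opprK.
have /(congr1 (intr : int -> rat)) := laplacian_all_positive_row_sum i.
by rewrite (bigD1 i) //= rmorphD /= rmorph_sum => ->.
Qed.

(** * Firing in potential coordinates *)

Definition potential c : 'cV[rat]_(nonsink q) :=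
  toQ M *m invmx (toQ L) *m toQ c.

Lemma validP c : reflect (forall i, 0 <= potential c i 0) (valid G c).
Proof. exact: forallP. Qed.

Lemma potentialD c d : potential (c + d) = potential c + potential d.
Proof. by rewrite /potential map_mxD mulmxDr. Qed.

Lemma potential_laplacian (u : config q) : potential (L *m u) = toQ (M *m u).
Proof. by rewrite /potential !map_mxM mulmxA mulmxKV ?laplacian_unitmx. Qed.

Lemma valid_add c d : valid G c -> valid G d -> valid G (c + d).
Proof.
by move=> /validP vc /validP vd; apply/validP=> i; rewrite potentialD mxE addr_ge0.
Qed.

Lemma potential_fire c j i :
  potential (fire G c j) i 0 = potential c i 0 - (M i j)%:~R.
Proof.
by rewrite /fire -mulmxN potentialD potential_laplacian mulmxN -colE !mxE rmorphN.
Qed.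

Lemma potential_fire_ge c i j : i != j ->
  potential c i 0 <= potential (fire G c j) i 0.
Proof.
move=> nij; rewrite potential_fire lerBrDr gerDl lerz0.
exact: laplacian_all_positive_off_le0.
Qed.

Lemma fireC c i j : fire G (fire G c i) j = fire G (fire G c j) i.
Proof. by rewrite /fire addrAC. Qed.

Lemma fireD c d i : fire G (c + d) i = fire G c i + d.
Proof. by rewrite /fire addrAC. Qed.

(** Firing [j] can lower only coordinate [j] of the potential, and firing [i]
    only coordinate [i]; at each coordinate the order can be chosen so that the
    last firing is harmless. *)
Lemma ready_fire c i j : i != j ->
  ready G c i -> ready G c j -> ready G (fire G c j) i.
Proof.
move=> nij /validP ri /validP rj; apply/validP=> l.
have [->|nli] := eqVneq l i.
  by rewrite fireC (le_trans (ri i)) // potential_fire_ge.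
by rewrite (le_trans (rj l)) // potential_fire_ge.
Qed.

Lemma fires_to_refl c : fires_to G c c.
Proof. by exists [::]. Qed.

Lemma fires_to_step c i d :
  valid G c -> ready G c i -> fires_to G (fire G c i) d -> fires_to G c d.
Proof.
move=> vc ri [s ps ls]; exists (fire G c i :: s) => //=.
by rewrite ps andbT /legal_firing vc; apply/existsP; exists i; rewrite ri eqxx.
Qed.

Lemma fires_to_ind (P : config q -> config q -> Prop) :
  (forall c, P c c) ->
  (forall c i d, valid G c -> ready G c i -> fires_to G (fire G c i) d ->
     P (fire G c i) d -> P c d) ->
  forall c d, fires_to G c d -> P c d.
Proof.
move=> P0 PS c d [s]; elim: s c => [|c1 s IHs] c /=; first by move=> _ <-.
case/andP=> /andP[vc /existsP[i /andP[ri /eqP->]]] ps ls.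
by apply: (PS c i) => //; [exists s | exact: IHs].
Qed.

Lemma fires_to_trans c d e : fires_to G c d -> fires_to G d e -> fires_to G c e.
Proof.
move: c d; apply: fires_to_ind => // c i d vc ri _ IH de.
exact: fires_to_step vc ri (IH de).
Qed.

Lemma fires_to_add e c d :
  valid G e -> fires_to G c d -> fires_to G (c + e) (d + e).
Proof.
move=> ve; move: c d; apply: fires_to_ind => [c|c i d vc ri _ IH].
  exact: fires_to_refl.
by apply: (@fires_to_step _ i); rewrite ?/ready ?fireD //; exact: valid_add.
Qed.

(** A site that is ready must fire before a stable configuration is reached,
    since only its own firing can make it unready; as firings commute, that
    firing can be moved to the front. *)
Lemma fires_to_stable_exchange c d i :
  fires_to G c d -> stable G d -> ready G c i -> fires_to G (fire G c i) d.
Proof.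
move=> cd; move: c d cd i.
apply: fires_to_ind => [c i sc|c j d vc rj jd IH i sd ri].
  by rewrite (negPf (sc i)).
have [<-//|nij] := eqVneq j i.
apply: (@fires_to_step _ j) => //; first exact: ready_fire.
by rewrite fireC; apply: IH => //; apply: ready_fire; rewrite // eq_sym.
Qed.

Lemma fires_to_confluent c d e :
  fires_to G c d -> fires_to G c e -> stable G e -> fires_to G d e.
Proof.
move=> cd; move: c d cd e; apply: fires_to_ind => // c i d vc ri _ IH e ce se.
exact/IH/se/fires_to_stable_exchange.
Qed.

Lemma fires_to_stable_eq c d : fires_to G c d -> stable G c -> d = c.
Proof.
move: c d; apply: fires_to_ind => // c i d _ ri _ _ sc.
by rewrite (negPf (sc i)) in ri.
Qed.

Lemma sum_potential_fire c j :
  \sum_i potential (fire G c j) i 0 = \sum_i potential c i 0 - 1.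
Proof.
under eq_bigr do rewrite potential_fire.
by rewrite sumrB -rmorph_sum laplacian_all_positive_col_sum.
Qed.

(** The sum of the potential of a valid configuration is nonnegative and drops
    by 1 at each firing, so legal firings terminate. *)
Lemma stabilizable c : valid G c -> exists d, fires_to G c d /\ stable G d.
Proof.
pose w c := \sum_i potential c i 0.
have [n] : exists n : nat, w c < n%:R.
  exists (Num.bound `|w c|).
  exact: le_lt_trans (ler_norm _) (archi_boundP (normr_ge0 _)).
elim: n c => [|n IHn] c ltwn vc.
  by move: ltwn; rewrite ltNge sumr_ge0 // => i _; exact/validP.
case: (pickP (ready G c)) => [i ri|sc]; last first.
  by exists c; split; [exact: fires_to_refl | move=> i; rewrite sc].
have [||d [cd sd]] := IHn (fire G c i) => //.
  by rewrite /w sum_potential_fire ltrBlDr natr1.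
by exists d; split=> //; exact: fires_to_step cd.
Qed.

Lemma stabP c d : valid G c -> d = stab G c <-> fires_to G c d /\ stable G d.
Proof.
move=> vc; have [cs ss] : fires_to G c (stab G c) /\ stable G (stab G c).
  exact: classical_sets.xgetPex (stabilizable vc).
split=> [->//|[cd sd]].
by apply/esym/(fires_to_stable_eq _ sd); exact: fires_to_confluent cd cs ss.
Qed.

(** * Burning *)

(** Adding [L] times the indicator of [B] undoes one firing of each site of [B].
    If every site is ready in [d], the sites of [B] can be fired in any order:
    the condition at a coordinate [l] is that the entries of row [l] of [M] in
    the columns still to be fired, and in column [l] itself, have a nonnegative
    sum. *)
Lemma fires_to_burn_set d (B : {set 'I_(nonsink q)}) :
  valid G d -> (forall i, ready G d i) ->
  fires_to G (d + L *m \col_i (i \in B)%:R) d.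
Proof.
move=> vd rd.
have validB (A : {set 'I_(nonsink q)}) : valid G (d + L *m \col_i (i \in A)%:R).
  have potA l : potential (d + L *m \col_i (i \in A)%:R) l 0
              = potential d l 0 + (\sum_(i in A) M l i)%:~R.
    rewrite potentialD potential_laplacian !mxE; congr (_ + _%:~R).
    rewrite [RHS]big_mkcond; apply: eq_bigr => i _; rewrite [X in _ * X]mxE.
    by case: (i \in A); rewrite ?mulr1 ?mulr0.
  apply/validP=> l; rewrite potA; have [lA|lA] := boolP (l \in A).
    rewrite addr_ge0 ?ler0z ?laplacian_all_positive_sum_ge0 //.
    exact/validP.
  have /validP/(_ l) := rd l; rewrite potential_fire => rdl.
  have := laplacian_all_positive_sum_ge0 (setU11 l A).
  rewrite big_setU1 //= -(ler0z rat) rmorphD /=; lra.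
have [n] := ubnP #|B|; elim: n B => // n IHn B leBn.
have [->|[i iB]] := set_0Vmem B.
  rewrite [X in L *m X](_ : _ = 0); last by apply/colP=> i; rewrite !mxE inE.
  by rewrite mulmx0 addr0; exact: fires_to_refl.
have fireB : fire G (d + L *m \col_j (j \in B)%:R) i
           = d + L *m \col_j (j \in B :\ i)%:R.
  rewrite /fire -addrA -mulmxBr; congr (_ + _ *m _); apply/colP=> j.
  by rewrite !mxE !inE andbT; case: eqVneq => [->|_]; rewrite ?iB ?subrr ?subr0.
apply: (@fires_to_step _ i); rewrite /ready ?fireB //; apply: IHn.
by move: leBn; rewrite (cardsD1 i) iB.
Qed.

Lemma fires_to_burn d :
  valid G d -> (forall i, ready G d i) -> fires_to G (d + L *m const_mx 1) d.
Proof.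
move=> vd rd; have := fires_to_burn_set [set: _] vd rd.
rewrite [X in L *m X](_ : _ = const_mx 1) //.
by apply/colP=> i; rewrite !mxE inE.
Qed.

Lemma potential_burn : potential (L *m const_mx 1) = const_mx 1.
Proof.
rewrite potential_laplacian; apply/colP=> i; rewrite !mxE.
rewrite -[RHS](rmorph1 intr); congr _%:~R.
rewrite -[RHS](laplacian_all_positive_row_sum i).
by apply: eq_bigr => j _; rewrite [X in _ * X]mxE mulr1.
Qed.

Lemma valid_burn : valid G (L *m const_mx 1).
Proof. by apply/validP=> i; rewrite potential_burn mxE. Qed.

(** Dhar's burning criterion, with [L 1] as the burning configuration. Stable
    configurations fire nowhere, so confluence does the forward direction; for
    the converse, [c + N L 1] serves as the configuration with all sites ready. *)
Lemma critical_burning c : valid G c ->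
  critical G c <-> c = stab G (c + L *m const_mx 1).
Proof.
move=> vc; rewrite stabP ?valid_add ?valid_burn //; split.
  case=> sc [d [vd rd dc]]; split=> //.
  apply: fires_to_confluent sc; first exact: fires_to_add valid_burn dc.
  exact: fires_to_trans (fires_to_burn vd rd) dc.
case=> cc sc; split=> //.
pose K : config q := L *m const_mx 1.
have vN N : valid G (c + K *+ N).
  by elim: N => [|N IHN]; rewrite ?addr0 // mulrSr addrA valid_add ?valid_burn.
have cN N : fires_to G (c + K *+ N) c.
  elim: N => [|N IHN]; first by rewrite addr0; exact: fires_to_refl.
  rewrite mulrSr addrA; apply: fires_to_trans cc.
  exact: fires_to_add valid_burn IHN.
have potN N l : potential (c + K *+ N) l 0 = potential c l 0 + N%:R.
  elim: N => [|N IHN]; first by rewrite !addr0.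
  by rewrite mulrSr addrA potentialD mxE IHN potential_burn [const_mx _ _ _]mxE -addrA natr1.
(* Large enough for every site: the entries of [M] are bounded by [N]. *)
pose N := (\sum_l \sum_i `|M l i|)%N.
exists (c + K *+ N); split=> // i; apply/validP=> l.
rewrite potential_fire potN -addrA addr_ge0 //; first exact/validP.
rewrite subr_ge0 -[N%:R]/(N%:Z%:~R) ler_int.
apply: le_trans (ler_norm _) _; rewrite -abszE lez_nat /N.
by rewrite (bigD1 l) //= (bigD1 i) //= -addnA leq_addr.
Qed.

Lemma laplacian_const_regular mneg : signed_regular G q mneg ->
  L *m const_mx 1 = const_mx (1 + 2 * mneg)%N%:Z :> config q.
Proof.
case=> mpos hreg; apply/colP=> i; rewrite !mxE.
under eq_bigr do rewrite [X in _ * X]mxE mulr1.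
by rewrite laplacian_row_sum // (hreg _ (site_neq i)).2.
Qed.

End Dynamics.

Theorem corollary3p12 (V : finType) (G : signed_graph V) (q : V) (mneg : nat)
    (hq : universal_sink G q) (hreg : signed_regular G q mneg)
    (c : config q) (hc : valid G c) :
  critical G c <-> c = stab G (c + const_mx ((1 + 2 * mneg)%N%:Z)).
Proof.
by rewrite -(laplacian_const_regular hq hreg); exact: critical_burning.
Qed.
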